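(* Let $\lambda>0$, let $\bm{w}=(w_0,\dots,w_n)^T\in\mathbb{C}^{(n+1)\times 1}$, and let $K\in\mathbb{C}^{(n+1)\times(n+1)}$ be a strictly positive definite (Hermitian) matrix with entries $K(z_i,z_j)$, $0\le i,j\le n$. For $\bm{\alpha}=(\alpha_0,\dots,\alpha_n)^T\in\mathbb{C}^{(n+1)\times1}$ let $$J(\bm{\alpha})=(\bm{w}-K\bm{\alpha})^*(\bm{w}-K\bm{\alpha})+\lambda\,\bm{\alpha}^*K\bm{\alpha}.$$ Then $J(\bm{\alpha})$ is minimized (over $\mathbb{C}^{(n+1)\times1}$) at $\bm{\alpha}$ if and only if $$\bm{w}=(K+\lambda I)\bm{\alpha}.$$
   Context: Here $z_0,\dots,z_n$ are points of a non-empty set $\Omega\subseteq\mathbb{C}$ and $K(\cdot,\cdot)$ is a positive definite kernel on $\Omega$; the matrix $K$ is its Gram matrix at these points. $(\cdot)^*$ denotes the conjugate transpose and $I$ the identity matrix. *)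

(* Defs.v *)
From mathcomp Require Import all_boot all_order all_algebra.
From mathcomp Require Import sesquilinear spectral.
From mathcomp Require Import boolp classical_sets reals.
From mathcomp Require Import complex.

Set Implicit Arguments.
Unset Strict Implicit.
Unset Printing Implicit Defensive.

Import Order.TTheory GRing.Theory Num.Theory.
Local Open Scope ring_scope.
Local Open Scope complex_scope.
Local Open Scope sesquilinear_scope.

(* On R[i], [x <= y] means that x and y have the same imaginary part and
   Re x <= Re y; in particular [0 <= x] says that x is real and nonnegative. *)

Section PositiveDefinite.
Variable R : realType.

Definition possemidefmx n (A : 'M[R[i]]_n) : Prop :=
  A \is hermsymmx /\ forall a : 'cV[R[i]]_n, 0 <= (a^t* *m A *m a) 0 0.

Definition posdefmx n (A : 'M[R[i]]_n) : Prop :=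
  A \is hermsymmx /\
  forall a : 'cV[R[i]]_n, a != 0 -> 0 < (a^t* *m A *m a) 0 0.

Definition gram_mx (k : R[i] -> R[i] -> R[i]) n (z : 'I_n -> R[i]) :
    'M[R[i]]_n :=
  \matrix_(i, j) k (z i) (z j).

(* A kernel on Omega is a total function of which only the values on
   Omega x Omega matter. The points of a Gram matrix may repeat. *)
Definition pd_kernel (Omega : set R[i]) (k : R[i] -> R[i] -> R[i]) : Prop :=
  forall m (x : 'I_m -> R[i]),
    (forall i, Omega (x i)) -> possemidefmx (gram_mx k x).

End PositiveDefinite.

(* The value is written in R[i], but it is real when K is Hermitian, so that
   comparing two values in the order of R[i] is comparing real numbers. *)
Definition ridge_cost (R : realType) n (K : 'M[R[i]]_n) (w : 'cV[R[i]]_n)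
    (lambda : R) (a : 'cV[R[i]]_n) : R[i] :=
  ((w - K *m a)^t* *m (w - K *m a)) 0 0 + lambda%:C * (a^t* *m K *m a) 0 0.

Definition is_minimizer (R : realType) (T : Type) (f : T -> R[i]) (a : T) :
    Prop :=
  forall b, f a <= f b.

(* Main.v *)
Require Import Defs.
From mathcomp Require Import all_boot all_order all_algebra.
From mathcomp Require Import sesquilinear spectral.
From mathcomp Require Import boolp classical_sets reals.
From mathcomp Require Import complex.
From mathcomp Require Import ring.

Set Implicit Arguments.
Unset Strict Implicit.
Unset Printing Implicit Defensive.

Import Order.TTheory GRing.Theory Num.Theory.
Local Open Scope classical_set_scope.
Local Open Scope ring_scope.
Local Open Scope complex_scope.

(** The cost [J] is a quadratic function over the reals, so it equals its
    second-order expansion exactly: with [r = w - (K + lambda I) a], every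
    direction [h] satisfies
      [J (a + h) - J a = Q h - ((K h)^* r + r^* (K h))],
      [Q h = (K h)^* (K h) + lambda h^* K h],
    by the Hermitian symmetry of [K] ([ridge_costD]).  The quadratic part [Q] is
    nonnegative because [K] is, so [a] is a minimizer as soon as [r = 0].

    Conversely, if [r != 0], strict positivity of [K] makes [r] itself a
    direction of strict descent: along [h = t r] with [t] real the difference
    is [t^2 Q r - 2 t (r^* K r)], where [r^* K r > 0], and it is negative at
    [t = r^* K r / Q r], where this parabola has its vertex
    ([ridge_cost_descent]).  Moving along [r] rather than along the steepest
    descent direction [K r] makes the linear term the form [r^* K r] itself, so
    that the positivity of [K] applies to it directly. *)

Section HermitianProduct.
Variable C : numClosedFieldType.
Local Open Scope sesquilinear_scope.

Definition hdot n (u v : 'cV[C]_n) : C := (u^t* *m v) 0 0.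

Lemma hdotDl n (u1 u2 v : 'cV[C]_n) :
  hdot (u1 + u2) v = hdot u1 v + hdot u2 v.
Proof. by rewrite /hdot linearD map_mxD mulmxDl mxE. Qed.

Lemma hdotDr n (u v1 v2 : 'cV[C]_n) :
  hdot u (v1 + v2) = hdot u v1 + hdot u v2.
Proof. by rewrite /hdot mulmxDr mxE. Qed.

Lemma hdotZl n c (u v : 'cV[C]_n) : hdot (c *: u) v = c^* * hdot u v.
Proof. by rewrite /hdot linearZ map_mxZ -scalemxAl mxE. Qed.

Lemma hdotZr n c (u v : 'cV[C]_n) : hdot u (c *: v) = c * hdot u v.
Proof. by rewrite /hdot -scalemxAr mxE. Qed.

Lemma hdotNl n (u v : 'cV[C]_n) : hdot (- u) v = - hdot u v.
Proof. by rewrite -scaleN1r hdotZl rmorphN1 mulN1r. Qed.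

Lemma hdotNr n (u v : 'cV[C]_n) : hdot u (- v) = - hdot u v.
Proof. by rewrite -scaleN1r hdotZr mulN1r. Qed.

Lemma hdot_ge0 n (u : 'cV[C]_n) : 0 <= hdot u u.
Proof.
by rewrite /hdot mxE sumr_ge0 // => i _; rewrite !mxE mulrC mul_conjC_ge0.
Qed.

Lemma hdot_hermitian n (K : 'M[C]_n) (u v : 'cV[C]_n) :
  K \is hermsymmx -> hdot (K *m u) v = hdot u (K *m v).
Proof.
move=> /is_hermitianmxP; rewrite expr0 scale1r => KE.
by rewrite /hdot trmx_mul map_mxM -KE mulmxA.
Qed.

End HermitianProduct.

Section RidgeCost.
Variables (R : realType) (n : nat) (K : 'M[R[i]]_n) (w : 'cV[R[i]]_n).
Variable lambda : R.

(** For [K] Hermitian, half the real gradient of the cost at [a] is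
    [- K (ridge_residual a)]. *)
Definition ridge_residual (a : 'cV[R[i]]_n) : 'cV[R[i]]_n :=
  w - (K + (lambda%:C)%:M) *m a.

Definition ridge_quad (h : 'cV[R[i]]_n) : R[i] :=
  hdot (K *m h) (K *m h) + lambda%:C * hdot h (K *m h).

Lemma ridge_costE a :
  ridge_cost K w lambda a =
  hdot (w - K *m a) (w - K *m a) + lambda%:C * hdot a (K *m a).
Proof. by rewrite /ridge_cost /hdot !mulmxA. Qed.

(** The exact second-order expansion of the cost: the penalty contributes
    [lambda ((K h)^* a + a^* (K h))] to the linear part once [K] is moved across
    the product, and this merges with the contribution of the data term
    into the residual. *)
Lemma ridge_costD a h :
  K \is hermsymmx ->
  ridge_cost K w lambda (a + h) =
  ridge_cost K w lambda a + ridge_quad h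
  - (hdot (K *m h) (ridge_residual a) + hdot (ridge_residual a) (K *m h)).
Proof.
move=> Kherm.
rewrite !ridge_costE /ridge_quad /ridge_residual mulmxDl mul_scalar_mx mulmxDr.
rewrite !opprD !(hdotDl, hdotDr, hdotNl, hdotNr, hdotZl, hdotZr).
rewrite -[hdot h (K *m a)]hdot_hermitian //.
have -> : Num.conj lambda%:C = lambda%:C by exact: conjc_real.
ring.
Qed.

Lemma ridge_quadZ (t : R[i]) h :
  t \is Num.real -> ridge_quad (t *: h) = t ^+ 2 * ridge_quad h.
Proof.
move=> /CrealP tE.
rewrite /ridge_quad -scalemxAr !(hdotZl, hdotZr) tE; ring.
Qed.

Hypotheses (K_pd : posdefmx K) (lambda_gt0 : 0 < lambda).

Lemma posdefmx_hdot_gt0 h : h != 0 -> 0 < hdot h (K *m h).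
Proof. by move=> h0; rewrite /hdot mulmxA; apply: K_pd.2. Qed.

Lemma ridge_quad_gt0 h : h != 0 -> 0 < ridge_quad h.
Proof.
move=> h0; rewrite ltr_wpDl ?hdot_ge0 // mulr_gt0 ?posdefmx_hdot_gt0 //.
by rewrite ltcR.
Qed.

Lemma ridge_quad_ge0 h : 0 <= ridge_quad h.
Proof.
have [->|/ridge_quad_gt0/ltW//] := eqVneq h 0.
by rewrite /ridge_quad /hdot !mulmx0 !mxE mulr0 addr0.
Qed.

(** The witness is [a + t r] for the residual [r]: the cost changes by
    [t^2 q - 2 t c], with [c = r^* K r] and [q] the quadratic part at [r], both
    positive, and at the vertex [t = c / q] this is [- c^2 / q]. *)
Lemma ridge_cost_descent a :
  ridge_residual a != 0 ->
  exists b, ridge_cost K w lambda b < ridge_cost K w lambda a.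
Proof.
set r := ridge_residual a => r0.
have c_gt0 := posdefmx_hdot_gt0 r0; have q_gt0 := ridge_quad_gt0 r0.
set c := hdot r (K *m r) in c_gt0; set q := ridge_quad r in q_gt0.
pose t := c / q.
have t_real : t \is Num.real by rewrite ger0_real // ltW // divr_gt0.
exists (a + t *: r); rewrite ridge_costD ?K_pd.1 // ridge_quadZ // -/r -/q.
rewrite -scalemxAr hdotZl hdotZr (CrealP t_real) hdot_hermitian ?K_pd.1 // -/c.
rewrite -addrA gtrDl.
have -> : t ^+ 2 * q - (t * c + t * c) = - (c ^+ 2 / q).
  by rewrite /t; field; rewrite gt_eqF.
by rewrite oppr_lt0 divr_gt0 // exprn_gt0.
Qed.

End RidgeCost.

Theorem proposition3p5 (R : realType) (n : nat)
    (Omega : set R[i]) (Omega_neq0 : Omega !=set0)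
    (k : R[i] -> R[i] -> R[i]) (k_pd : pd_kernel Omega k)
    (z : 'I_n.+1 -> R[i]) (z_Omega : forall i, Omega (z i))
    (K_pd : posdefmx (gram_mx k z))
    (lambda : R) (lambda_gt0 : 0 < lambda)
    (w : 'cV[R[i]]_n.+1) (alpha : 'cV[R[i]]_n.+1) :
  is_minimizer (ridge_cost (gram_mx k z) w lambda) alpha <->
  w = (gram_mx k z + (lambda%:C)%:M) *m alpha.
Proof.
set K := gram_mx k z in K_pd *; split=> [alpha_min | /eqP].
  apply/eqP; rewrite -subr_eq0; apply/negP => /negP.
  move=> /(ridge_cost_descent K_pd lambda_gt0)[b].
  by move/lt_le_trans/(_ (alpha_min b)); rewrite ltxx.
rewrite -subr_eq0 => /eqP r0 b.
rewrite -[b](subrKC alpha) ridge_costD ?K_pd.1 // /ridge_residual r0.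
rewrite /hdot mulmx0 linear0 map_mx0 mul0mx !mxE addr0 subr0.
by rewrite lerDl ridge_quad_ge0.
Qed.
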